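(* Let $m\neq 0$ and $a$ be real numbers. For every integer $n\ge 0$ and every real $x$ with $m+2x\neq 0$, the noncentral Tanny-Dowling polynomials satisfy the explicit formula $$\widetilde{\mathcal F}_{m,2a}(n;x)=\sum_{k=0}^n k!\,x^k\left[\frac{2^{n+1}(m+x)\,x^k\,\widetilde W_{m,a}(n,k)+(-m)^{k+1}\,\widetilde W_{m,2a}(n,k)}{(m+2x)^{k+1}}\right],$$ where $\widetilde W_{m,a}(n,k)$ and $\widetilde W_{m,2a}(n,k)$ are noncentral Whitney numbers of the second kind.
   Context: For real $m\ne0$ and real $a$, the noncentral Whitney numbers of the second kind $\widetilde W_{m,a}(n,k)$ ($0\le k\le n$) are given by $\sum_{n\ge k}\widetilde W_{m,a}(n,k)\frac{z^n}{n!}=\frac{e^{-az}}{k!}\left(\frac{e^{mz}-1}{m}\right)^k$. The noncentral Tanny-Dowling polynomials are $\widetilde{\mathcal F}_{m,a}(n;x)=\sum_{k=0}^n k!\,\widetilde W_{m,a}(n,k)x^k$; equivalently, as formal power series in $z$, $\sum_{n\ge0}\widetilde{\mathcal F}_{m,a}(n;x)\frac{z^n}{n!}=\frac{me^{-az}}{m-x(e^{mz}-1)}$. Convention: $0^0=1$. *)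

(* Defs.v *)
From mathcomp Require Import all_boot all_order all_algebra.
From mathcomp Require Import reals.
From mathcomp Require Import zify.

Set Implicit Arguments.
Unset Strict Implicit.
Unset Printing Implicit Defensive.

Import Order.TTheory GRing.Theory Num.Theory.
Local Open Scope ring_scope.

(* A formal power series \sum_n f_n z^n is encoded by its coefficient         *)
(* sequence f : nat -> R.                                                     *)

Section NoncentralWhitney.
Variable R : realType.
Implicit Types (f g : nat -> R) (m a c : R) (n k : nat).

Definition fps_one : nat -> R := fun n => (n == 0%N)%:R.

Definition fps_mul f g : nat -> R :=
  fun n => \sum_(i < n.+1) f i * g (n - i)%N.

Definition fps_pow f k : nat -> R := iter k (fps_mul f) fps_one.

(* e^{cz} *)
Definition fps_exp c : nat -> R := fun n => c ^+ n / n`!%:R.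

(* (e^{mz} - 1) / m *)
Definition whitney_base m : nat -> R :=
  fun n => (fps_exp m n - fps_one n) / m.

(* e^{-az} / k! * ((e^{mz} - 1) / m)^k *)
Definition whitney2_egf m a k : nat -> R :=
  fun n => fps_mul (fps_exp (- a)) (fps_pow (whitney_base m) k) n / k`!%:R.

(* Noncentral Whitney numbers of the second kind: whitney2_egf m a k is their *)
(* exponential generating function in n, hence the factor n!.                 *)
Definition whitney2 m a n k : R := n`!%:R * whitney2_egf m a k n.

(* Noncentral Tanny-Dowling polynomials, in the variable x = 'X. *)
Definition tanny_dowling m a n : {poly R} :=
  \sum_(k < n.+1) (k`!%:R * whitney2 m a n k) *: 'X^k.

Lemma fps_pow_whitney_base_small m k n :
  (n < k)%N -> fps_pow (whitney_base m) k n = 0.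
Proof.
elim: k n => // k IHk n lt_nk.
have -> : fps_pow (whitney_base m) k.+1 n =
    \sum_(i < n.+1) whitney_base m i * fps_pow (whitney_base m) k (n - i)%N.
  by [].
apply: big1 => i _; case: (posnP i) => [i0|i_gt0].
  have -> : whitney_base m i = 0.
    by rewrite i0 /whitney_base /fps_exp /fps_one eqxx expr0 fact0 divr1 subrr mul0r.
  by rewrite mul0r.
rewrite IHk ?mulr0 //; move: (ltn_ord i); lia.
Qed.

(* The generating function starts at z^k, so it is \sum_(n >= k). *)
Lemma whitney2_small m a n k : (n < k)%N -> whitney2 m a n k = 0.
Proof.
move=> lt_nk; rewrite /whitney2 /whitney2_egf /fps_mul big1 ?mul0r ?mulr0 // => i _.
by rewrite fps_pow_whitney_base_small ?mulr0 // (leq_ltn_trans (leq_subr _ _)).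
Qed.

End NoncentralWhitney.

(* Main.v *)
Require Import Defs.
From mathcomp Require Import all_boot all_order all_algebra.
From mathcomp Require Import reals.
From mathcomp Require Import ring zify.

(** Put u = (e^(mz) - 1) / m, so that the Tanny-Dowling polynomials with
    parameters m and 2a have exponential generating function
    e^(-2az) / (1 - x u).  Scaling the n-th coefficient of a series by 2^n
    substitutes 2z for z: this turns e^(-az) into e^(-2az) and u into
    U = m u^2 + 2 u.  The right-hand side therefore has generating function
      e^(-2az) (alpha / (1 - w) - beta / (1 - v)),
    where alpha = 2 (m + x) / (m + 2x), beta = m / (m + 2x),
    w = x^2 U / (m + 2x) and v = - m x u / (m + 2x).  With y = x u, the relation
    between U and u factors 1 - w as (1 - y) (1 - v), while
    alpha - beta (1 - y) = 1 - v; hence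
      1 / (1 - y) = alpha / (1 - w) - beta / (1 - v),
    which is the theorem.

    Only the coefficients up to z^n matter, so series are replaced by
    polynomials modulo 'X^N with N = n + 1, and 1 / (1 - t) by the geometric
    sum of the t^k for k < N, which is an inverse of 1 - t modulo 'X^N as soon
    as 'X divides t (geom_sum_inverse).  The partial fraction identity is
    geom_sum_partial_fractions, the relation between U and u is
    base_poly_double, and whitney2_coef and whitney2_coef_double translate
    Whitney numbers into coefficients of such polynomials. *)

Set Implicit Arguments.
Unset Strict Implicit.
Unset Printing Implicit Defensive.

Import Order.TTheory GRing.Theory Num.Theory.
Local Open Scope ring_scope.

(** * Geometric sums modulo a power of 'X *)

Section Truncation.
Variable F : fieldType.
Implicit Types (p q t v w y : {poly F}) (N : nat).

Lemma dvdp_XnP N p :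
  reflect (forall i, (i < N)%N -> p`_i = 0) ('X^N %| p).
Proof.
apply: (iffP idP) => [/dvdpP[q ->] i lt_iN | p0]; first by rewrite coefMXn lt_iN.
rewrite -(poly_take_drop N p).
suff -> : take_poly N p = 0 by rewrite add0r dvdp_mull.
apply/polyP=> i; rewrite coef_take_poly coef0.
by case: ifP => // /p0.
Qed.

Definition geom_sum N t : {poly F} := \sum_(k < N) t ^+ k.

(** Modulo 'X^N this is the geometric series: the error is t^N. *)
Lemma geom_sum_inverse N t :
  'X %| t -> 'X^N %| (1 - t) * geom_sum N t - 1.
Proof.
move=> Xt; have -> : (1 - t) * geom_sum N t - 1 = - t ^+ N.
  by rewrite -(opprB t 1) mulNr -subrX1; ring.
by rewrite dvdpNr dvdp_exp2r.
Qed.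

Lemma coprimep_Xn_1subr N t : 'X %| t -> coprimep 'X^N (1 - t).
Proof.
move=> Xt; apply: coprimep_expl; rewrite coprimep_sym -['X]subr0 -polyC0.
rewrite coprimep_XsubC /root !hornerE.
by have /eqP -> : t.[0] == 0; rewrite ?subr0 ?oner_eq0 // -/(root t 0) -dvdp_XsubCl subr0.
Qed.

(** Both sides become congruent after multiplication by (1 - y) (1 - v), which
    is invertible modulo 'X^N. *)
Lemma geom_sum_partial_fractions N (alpha beta y v w : {poly F}) :
    'X %| y -> 'X %| v -> 'X %| w ->
    'X^N %| (1 - y) * (1 - v) - (1 - w) ->
    alpha - beta * (1 - y) = 1 - v ->
  'X^N %| geom_sum N y - (alpha * geom_sum N w - beta * geom_sum N v).
Proof.
move=> Xy Xv Xw factor_w split_v.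
have cop : coprimep 'X^N ((1 - y) * (1 - v)).
  by rewrite coprimepMr !coprimep_Xn_1subr.
rewrite -(Gauss_dvdpr _ cop).
have invy := geom_sum_inverse N Xy; have invv := geom_sum_inverse N Xv.
have invw := geom_sum_inverse N Xw.
set Gy := geom_sum N y in invy *; set Gv := geom_sum N v in invv *.
set Gw := geom_sum N w in invw *.
have -> : (1 - y) * (1 - v) * (Gy - (alpha * Gw - beta * Gv)) =
    (1 - v) * ((1 - y) * Gy - 1) - alpha * ((1 - w) * Gw - 1)
    - (alpha * Gw) * ((1 - y) * (1 - v) - (1 - w))
    + (beta * (1 - y)) * ((1 - v) * Gv - 1)
    + ((1 - v) - (alpha - beta * (1 - y))) by ring.
by rewrite split_v subrr addr0 dvdp_add ?dvdp_sub ?dvdp_mull.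
Qed.

Lemma coef_comp_scaleX p (c : F) i : (p \Po (c *: 'X))`_i = c ^+ i * p`_i.
Proof.
rewrite coef_comp_poly; under eq_bigr do rewrite exprZn coefZ coefXn.
have [lt_ip | le_pi] := ltnP i (size p).
  rewrite (bigD1 (Ordinal lt_ip)) //= eqxx mulr1 big1 ?addr0 1?mulrC // => j.
  by rewrite -val_eqE /= eq_sym => /negPf->; rewrite !mulr0.
rewrite nth_default // mulr0 big1 // => j _.
by rewrite gtn_eqF ?mulr0 // (leq_trans (ltn_ord j)).
Qed.

End Truncation.

(** * Polynomials that represent a power series *)

Section Representation.
Variable R : realType.
Implicit Types (f g : nat -> R) (P Q : {poly R}) (m a c : R) (N n k : nat).

Definition represents N P f := forall i, (i < N)%N -> P`_i = f i.

Lemma represents_mul N P Q f g :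
  represents N P f -> represents N Q g -> represents N (P * Q) (fps_mul f g).
Proof.
move=> Pf Qg i lt_iN; rewrite coefM; apply: eq_bigr => j _.
by rewrite Pf ?Qg //; move: (ltn_ord j); lia.
Qed.

Lemma represents_pow N P f k :
  represents N P f -> represents N (P ^+ k) (fps_pow f k).
Proof.
move=> Pf; elim: k => [|k IHk]; first by move=> i _; rewrite expr0 coef1.
by rewrite exprS; apply: represents_mul.
Qed.

Definition exp_poly N c : {poly R} := \poly_(i < N) fps_exp c i.

Lemma exp_poly_represents N c : represents N (exp_poly N c) (fps_exp c).
Proof. by move=> i lt_iN; rewrite coef_poly lt_iN. Qed.

Lemma exp_poly_scaleX N c d : exp_poly N c \Po (d *: 'X) = exp_poly N (d * c).
Proof.
apply/polyP=> i; rewrite coef_comp_scaleX !coef_poly /fps_exp.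
by case: ifP; rewrite ?mulr0 // exprMn mulrA.
Qed.

Lemma natr_fact_neq0 n : n`!%:R != 0 :> R.
Proof. by rewrite pnatr_eq0 -lt0n fact_gt0. Qed.

Lemma fps_exp_add c d n : fps_mul (fps_exp c) (fps_exp d) n = fps_exp (c + d) n.
Proof.
rewrite /fps_mul /fps_exp addrC exprDn mulr_suml; apply: eq_bigr => i _.
have le_in : (i <= n)%N by rewrite -ltnS.
rewrite -(bin_fact le_in) !natrM -[_ *+ _]mulr_natr.
have bin_neq0 : 'C(n, i)%:R != 0 :> R by rewrite pnatr_eq0 -lt0n bin_gt0.
have := natr_fact_neq0 i; have := natr_fact_neq0 (n - i).
by move: bin_neq0 => h1 h2 h3; field; rewrite h1 h2 h3.
Qed.

Definition base_poly N m : {poly R} := m^-1 *: (exp_poly N m - 1).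

Lemma base_poly_represents N m : represents N (base_poly N m) (whitney_base m).
Proof.
by move=> i lt_iN; rewrite coefZ coefB coef1 exp_poly_represents // mulrC.
Qed.

Lemma dvdX_base_poly n m : 'X %| base_poly n.+1 m.
Proof.
rewrite -['X]expr1; apply/dvdp_XnP => -[|] // _.
rewrite base_poly_represents // /whitney_base /fps_exp /fps_one.
by rewrite expr0 fact0 divr1 subrr mul0r.
Qed.

(** This is e^(2mz) - 1 = (e^(mz) - 1) ((e^(mz) - 1) + 2), divided by m. *)
Lemma base_poly_double N m : m != 0 ->
  'X^N %| base_poly N m \Po (2 *: 'X)
          - (m *: base_poly N m ^+ 2 + 2 *: base_poly N m).
Proof.
move=> m_neq0; set E := exp_poly N m.
have -> : base_poly N m \Po (2 *: 'X)
    - (m *: base_poly N m ^+ 2 + 2 *: base_poly N m)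
    = m^-1 *: (exp_poly N (2 * m) - E * E).
  rewrite /base_poly comp_polyZ comp_polyB exp_poly_scaleX -polyC1 comp_polyC.
  rewrite -/E exprZn -!mul_polyC polyC1.
  have mVm : m%:P * (m^-1)%:P = 1 by rewrite -polyCM mulfV.
  have -> : m%:P * ((m^-1 ^+ 2)%:P * (E - 1) ^+ 2)
     = m%:P * (m^-1)%:P * (m^-1)%:P * (E - 1) ^+ 2 by rewrite expr2 polyCM; ring.
  by rewrite mVm (polyCMn 1 2); ring.
rewrite -mul_polyC; apply/dvdp_mull/dvdp_XnP => i lt_iN.
rewrite coefB exp_poly_represents //.
have -> := represents_mul (@exp_poly_represents N m) (@exp_poly_represents N m) lt_iN.
by rewrite fps_exp_add mulr_natl mulr2n subrr.
Qed.

Lemma whitney2_coef N m a n k : (n < N)%N ->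
  k`!%:R * whitney2 m a n k
    = n`!%:R * (exp_poly N (- a) * base_poly N m ^+ k)`_n.
Proof.
move=> lt_nN; rewrite /whitney2 /whitney2_egf.
have -> := represents_mul (@exp_poly_represents N (- a))
  (represents_pow k (@base_poly_represents N m)) lt_nN.
by have := natr_fact_neq0 k => k_neq0; field.
Qed.

(** The factor 2^n comes from substituting 2z for z, which also doubles the
    exponent of e^(-az). *)
Lemma whitney2_coef_double N m a n k : (n < N)%N ->
  2 ^+ n * (k`!%:R * whitney2 m a n k)
    = n`!%:R * (exp_poly N (- (2 * a)) * (base_poly N m \Po (2 *: 'X)) ^+ k)`_n.
Proof.
move=> lt_nN; rewrite (whitney2_coef _ _ _ lt_nN) mulrCA -coef_comp_scaleX.
by rewrite comp_polyM rmorphXn /= exp_poly_scaleX mulrN.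
Qed.

End Representation.

(** * The explicit formula *)

Lemma coef_geom_sumZ (F : fieldType) (N n : nat) (c : F) (E P : {poly F}) :
  (E * geom_sum N (c *: P))`_n = \sum_(k < N) c ^+ k * (E * P ^+ k)`_n.
Proof.
rewrite mulr_sumr coef_sum; apply: eq_bigr => k _.
by rewrite exprZn -scalerAr coefZ.
Qed.

Theorem theorem6 (R : realType) (m a : R) (hm : m != 0) (n : nat) (x : R)
    (hx : m + 2 * x != 0) :
  (tanny_dowling m (2 * a) n).[x] =
    \sum_(k < n.+1) k`!%:R * x ^+ k *
      ((2 ^+ n.+1 * (m + x) * x ^+ k * whitney2 m a n k
        + (- m) ^+ k.+1 * whitney2 m (2 * a) n k)
       / (m + 2 * x) ^+ k.+1).
Proof.
pose N := n.+1; pose E := exp_poly N (- (2 * a)).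
pose u := base_poly N m; pose U := u \Po (2 *: 'X).
pose s := m + 2 * x; pose alpha := 2 * (m + x) / s; pose beta := m / s.
pose y := x *: u; pose v := (- (m * x) / s) *: u; pose w := (x ^+ 2 / s) *: U.
have Xu : 'X %| u := dvdX_base_poly n m.
have XU : 'X %| U.
  rewrite -['X]expr1; apply/dvdp_XnP => i lt_i1.
  have /dvdp_XnP u0 : 'X^1 %| u by rewrite expr1.
  by rewrite coef_comp_scaleX u0 ?mulr0.
have s_neq0 : s != 0 by [].
have factor_w : 'X^N %| (1 - y) * (1 - v) - (1 - w).
  (* s (1 - v) = s + m x u is the cofactor of 1 - x u in
     s - x^2 (m u^2 + 2 u), which is s (1 - w) modulo 'X^N. *)
  have -> : (1 - y) * (1 - v) - (1 - w)
      = (x ^+ 2 / s) *: (U - (m *: u ^+ 2 + 2 *: u)).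
    rewrite /y /v /w; move: (u) (U) => p q; apply/polyP=> i.
    rewrite !mulrDl !mulrDr !mul1r !mulr1 !mulNr !mulrN -!scalerAl -!scalerAr.
    rewrite !(coefD, coefN, coefZ) -expr2 coef1.
    by rewrite /s; field.
  by rewrite -[X in _ %| X]mul_polyC; apply/dvdp_mull/base_poly_double.
have split_v : alpha%:P - beta%:P * (1 - y) = 1 - v.
  rewrite /y /v; move: (u) => p; apply/polyP=> i; rewrite mulrBr mulr1 mul_polyC.
  rewrite !(coefB, coefZ, coefC, coef1).
  by rewrite /alpha /beta /s; case: (i == 0)%N; rewrite ?mulr1n ?mulr0n; field.
have Xy : 'X %| y by rewrite -[X in _ %| X]mul_polyC; apply: dvdp_mull.
have Xv : 'X %| v by rewrite -[X in _ %| X]mul_polyC; apply: dvdp_mull.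
have Xw : 'X %| w by rewrite -[X in _ %| X]mul_polyC; apply: dvdp_mull.
have := geom_sum_partial_fractions Xy Xv Xw factor_w split_v.
move=> /(dvdp_mull E)/dvdp_XnP/(_ n (ltnSn n))/eqP.
rewrite mulrBr coefB subr_eq0 mulrBr !(mulrCA E) !mul_polyC coefB !coefZ.
rewrite !coef_geom_sumZ => /eqP coef_eq.
rewrite /tanny_dowling horner_sum.
transitivity (n`!%:R * \sum_(k < N) x ^+ k * (E * u ^+ k)`_n).
  rewrite mulr_sumr; apply: eq_bigr => k _.
  by rewrite hornerZ hornerXn (whitney2_coef _ _ _ (ltnSn n)) -/N -/E -/u; ring.
rewrite coef_eq mulrBr !mulr_sumr -sumrB; apply: eq_bigr => k _.
set W := whitney2 m a n k; set W2 := whitney2 m (2 * a) n k.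
have eqW : n`!%:R * (E * U ^+ k)`_n = 2 ^+ n * (k`!%:R * W).
  by rewrite (whitney2_coef_double _ _ _ (ltnSn n)).
have eqW2 : n`!%:R * (E * u ^+ k)`_n = k`!%:R * W2.
  by rewrite (whitney2_coef _ _ _ (ltnSn n)).
transitivity (alpha * (x ^+ 2 / s) ^+ k * (2 ^+ n * (k`!%:R * W))
              - beta * (- (m * x) / s) ^+ k * (k`!%:R * W2)).
  by rewrite -eqW -eqW2; ring.
rewrite -/s -(mulNr m x) !expr_div_n (exprMn _ (- m)) exprAC expr2 !exprS.
move: (expf_neq0 k s_neq0) => sk_neq0.
by rewrite /alpha /beta; field; rewrite sk_neq0 s_neq0.
Qed.
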